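(* Let $R$ be a countable ring, let $A$ be an uncountable Polish $R$-module, and let $\varphi(\mathbf u)$ and $\psi_i(\mathbf u)$ ($i<\omega$) be pp-formulae in the same tuple $\mathbf u$ of $n$ free variables such that $$\psi_0(A)\subseteq\psi_1(A)\subseteq\cdots\subseteq\psi_i(A)\subseteq\cdots\subseteq\varphi(A)\subseteq A^n.$$ If the pp-type $q(\mathbf u)=\{\varphi(\mathbf u)\}\cup\{\neg\psi_i(\mathbf u): i<\omega\}$ is consistent with the theory $\mathrm{Th}_{\mathrm{Pun}}(A)$, then the index $[\varphi(A):\sum_{i<\omega}\psi_i(A)]$ has the cardinality $\mathfrak c=2^{\aleph_0}$ of the continuum.
   Context: Rings have an identity $1\neq 0$; modules are unital left modules; a countable ring $R$ is given the discrete topology. A Polish $R$-module is an $R$-module $A$ with a separable completely metrizable topology for which $(A,+,-,0)$ is a topological group and scalar multiplication $R\times A\to A$ is continuous. A positive-primitive (pp) formula $\varphi(\mathbf u)$ in the language of $R$-modules is one equivalent, over the axioms of $R$-modules, to an existentially quantified finite system of homogeneous $R$-linear equations; $\varphi(M)\subseteq M^{|\mathbf u|}$ denotes its solution set in $M$, a subgroup. A pp-pair $\varphi/\psi$ consists of two pp-formulae in the same variables such that $\psi(\mathbf u)\to\varphi(\mathbf u)$ holds in every $R$-module (for arbitrary pp-formulae $\varphi,\psi$, write $\varphi/\psi$ for $\varphi/(\varphi\wedge\psi)$). The Polish unlimited theory $\mathrm{Th}_{\mathrm{Pun}}(A)$ of an $R$-module $A$ is the complete first-order theory of $R$-modules determined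 by prescribing, for every pp-pair $\varphi/\psi$: the index $[\varphi:\psi]$ is infinite if $[\varphi(A):\psi(A)]>\aleph_0$, and is $1$ if $[\varphi(A):\psi(A)]\le\aleph_0$. (This theory is consistent, and it is complete by the Baur--Monk theorem.) A set of formulae $q(\mathbf u)$ is consistent with a theory $T$ if $T\cup q(\mathbf u)$ is satisfiable, i.e. $q$ is realized in some model of $T$. *)

(* Defs.v *)
From HB Require Import structures.
From mathcomp Require Import all_boot all_order all_algebra.
From mathcomp Require Import all_classical all_reals all_analysis.

Set Implicit Arguments.
Unset Strict Implicit.
Unset Printing Implicit Defensive.

Import Order.TTheory GRing.Theory Num.Theory.

Local Open Scope classical_set_scope.
Local Open Scope ring_scope.

(* The library's topologicalLmodType only covers scalars in a numDomainType
   with its own topology, and its presence prevents HB from accepting another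
   join of topology and module structure; hence a plain record, whose carrier
   is then equipped with the instances of topologicalZmodType and lmodType R.
   Here R is an arbitrary ring with the discrete topology. *)
Record topModType (R : nzRingType) : Type := TopModType {
  topmod_group : topologicalZmodType;
  topmod_scale : R -> topmod_group -> topmod_group;
  topmod_scaleA : forall a b v,
    topmod_scale a (topmod_scale b v) = topmod_scale (a * b) v;
  topmod_scale1 : left_id 1 topmod_scale;
  topmod_scaleDr : right_distributive topmod_scale +%R;
  topmod_scaleDl : forall v, {morph topmod_scale^~ v : a b / a + b};
  topmod_scale_continuous :
    continuous (fun p : discrete_topology R * topmod_group =>
                  topmod_scale p.1 p.2)
}.

Definition topmod_sort (R : nzRingType) (A : topModType R) : Type :=
  topmod_group A.
Coercion topmod_sort : topModType >-> Sortclass.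

HB.instance Definition _ (R : nzRingType) (A : topModType R) :=
  TopologicalZmodule.on (topmod_sort A).
HB.instance Definition _ (R : nzRingType) (A : topModType R) :=
  GRing.Zmodule_isLmodule.Build R (topmod_sort A) (@topmod_scaleA R A)
    (@topmod_scale1 R A) (@topmod_scaleDr R A) (@topmod_scaleDl R A).

Definition separable (T : topologicalType) : Prop :=
  exists2 D : set T, countable D & dense D.

(* K is the field of real numbers; the metric d is not fixed, only the topology
   of T is. *)
Definition completely_metrizable (K : realType) (T : topologicalType) : Prop :=
  exists d : T -> T -> K,
    [/\ [/\ forall x, d x x = 0,
            forall x y, d x y = 0 -> x = y,
            forall x y, d x y = d y x &
            forall x y z, d x z <= d x y + d y z],
        forall (x : T) (U : set T),
          nbhs x U <-> exists2 e : K, 0 < e & [set y | d x y < e] `<=` U &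
        forall u : nat -> T,
          (forall e : K, 0 < e -> exists N : nat, forall i j : nat,
             (N <= i)%N -> (N <= j)%N -> d (u i) (u j) < e) ->
          exists l : T, u @ \oo --> l].

Definition polish (K : realType) (T : topologicalType) : Prop :=
  separable T /\ completely_metrizable K T.

(* The index [H : L] of a subgroup L in a subgroup H is the cardinality of
   this set. *)
Definition cosets (V : zmodType) (H L : set V) : set (set V) :=
  [set [set x + y | y in L] | x in H].

Definition sum_subgroups (V : zmodType) (L : nat -> set V) : set V :=
  [set x | exists (N : nat) (f : nat -> V),
     (forall i, L i (f i)) /\ x = \sum_(i < N) f i].

(* First-order language of left R-modules (+, -, 0 and one unary function
   symbol for each r in R).  Formulae are well-scoped: the free variables of
   f : formula R n are indexed by 'I_n, and under a quantifier the bound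
   variable is ord0, the others being shifted by lift ord0. *)
Inductive term (R : Type) (n : nat) : Type :=
| TVar of 'I_n
| TZero
| TOpp of term R n
| TAdd of term R n & term R n
| TScale of R & term R n.

Arguments TVar {R n}.
Arguments TZero {R n}.

Inductive formula (R : Type) : nat -> Type :=
| FEq n of term R n & term R n : formula R n
| FTrue n : formula R n
| FNot n of formula R n : formula R n
| FAnd n of formula R n & formula R n : formula R n
| FOr n of formula R n & formula R n : formula R n
| FImp n of formula R n & formula R n : formula R n
| FAll n of formula R n.+1 : formula R n
| FEx n of formula R n.+1 : formula R n.

Arguments FTrue {R n}.

Definition extend (T : Type) (n : nat) (x : T) (v : 'I_n -> T) : 'I_n.+1 -> T :=
  fun i => if unlift ord0 i is Some j then v j else x.

Section Semantics.
Variables (R : nzRingType) (M : lmodType R).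

Fixpoint eval_term n (t : term R n) (v : 'I_n -> M) : M :=
  match t with
  | TVar i => v i
  | TZero => 0
  | TOpp t => - eval_term t v
  | TAdd t s => eval_term t v + eval_term s v
  | TScale r t => r *: eval_term t v
  end.

Fixpoint sat n (f : formula R n) : ('I_n -> M) -> Prop :=
  match f in formula _ n return ('I_n -> M) -> Prop with
  | FEq _ t s => fun v => eval_term t v = eval_term s v
  | FTrue _ => fun=> True
  | FNot _ f => fun v => ~ sat f v
  | FAnd _ f g => fun v => sat f v /\ sat g v
  | FOr _ f g => fun v => sat f v \/ sat g v
  | FImp _ f g => fun v => sat f v -> sat g v
  | FAll _ f => fun v => forall x, sat f (extend x v)
  | FEx _ f => fun v => exists x, sat f (extend x v)
  end.

Definition solset n (f : formula R n) : set ('I_n -> M) := [set v | sat f v].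

Definition holds (s : formula R 0) : Prop := forall v : 'I_0 -> M, sat s v.

End Semantics.

Arguments solset {R} M {n} f.

Section PositivePrimitive.
Variable R : nzRingType.

Fixpoint exists_block m n : formula R (m + n) -> formula R n :=
  match m return formula R (m + n) -> formula R n with
  | 0%N => id
  | m'.+1 => fun f => exists_block (FEx f)
  end.

(* The finite system \sum_j C i j x_j = 0, one equation for each row i. *)
Definition linear_system k n (C : 'M[R]_(k, n)) : formula R n :=
  \big[@FAnd R n / FTrue]_(i < k)
    FEq (\big[@TAdd R n / TZero]_(j < n) TScale (C i j) (TVar j)) TZero.

Definition is_pp n (f : formula R n) : Prop :=
  exists m k (C : 'M[R]_(k, m + n)),
    forall (M : lmodType R) (v : 'I_n -> M),
      sat f v <-> sat (exists_block (linear_system C)) v.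

Definition is_pp_pair n (phi psi : formula R n) : Prop :=
  [/\ is_pp phi, is_pp psi &
      forall M : lmodType R, solset M psi `<=` solset M phi].

End PositivePrimitive.

Section PolishUnlimited.
Variable R : nzRingType.

Definition pun_prescription (A M : lmodType R) : Prop :=
  forall n (phi psi : formula R n), is_pp_pair phi psi ->
    let indexA := cosets (solset A phi) (solset A psi) in
    let indexM := cosets (solset M phi) (solset M psi) in
    (~ countable indexA -> infinite_set indexM) /\
    (countable indexA -> (indexM #= `I_1)%card).

(* The theory axiomatized by the prescription on indices: all sentences that
   hold in every R-module satisfying it (complete by the Baur-Monk theorem).
   By the definition of countable, ~ countable means cardinality > aleph_0. *)
Definition Th_Pun (A : lmodType R) : set (formula R 0) :=
  [set s | forall M : lmodType R, pun_prescription A M -> holds M s].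

Definition consistent n (T : set (formula R 0)) (q : set (formula R n)) : Prop :=
  exists M : lmodType R, (forall s, T s -> holds M s) /\
    exists u : 'I_n -> M, forall f, q f -> sat f u.

Definition pp_type n (phi : formula R n) (psi : nat -> formula R n) :
    set (formula R n) :=
  [set phi] `|` [set FNot (psi i) | i in [set: nat]].

End PolishUnlimited.

(* Main.v *)
Require Import Defs.
From HB Require Import structures.
From mathcomp Require Import all_boot all_order all_algebra.
From mathcomp Require Import all_classical all_reals all_analysis.
From mathcomp Require Import lra zify.

(** Consistency of the type makes each index [phi(A) : psi_i(A)] uncountable
    ([uncountable_index]); the rest is a category argument in a Polish group.

    The set phi(A) is the projection of the group H of solutions in a power of
    A of a linear system. By continuity of the module operations H is closed,
    hence a Polish group ([solution_group]). The preimage K_i of psi_i(A) in H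
    has the same uncountable index, and it is the image of another Polish group
    under a continuous homomorphism, namely of a fibre product of two solution
    groups. By an open mapping argument such an image is either open, hence of
    countable index since H is separable, or meager
    ([image_meager_or_countable_index]). So every K_i is meager, and so is
    their union. As the psi_i(A) increase, this union is the preimage of their
    sum.

    It remains to find continuum many elements of H whose pairwise differences
    avoid a given meager set ([cantor_scheme]). They are infinite sums of
    increments x_k chosen one after the other: each x_k is small and generic
    with respect to the finite sums of the previous ones, and each digit of a
    binary sequence decides about infinitely many increments. Two distinct
    sequences then disagree about x_k for arbitrarily large k, and this keeps
    the difference of their sums out of every nowhere dense piece. Conversely,
    a separable metric space has at most continuum many points
    ([card_carrier_le]). *)

Set Implicit Arguments.
Unset Strict Implicit.
Unset Printing Implicit Defensive.

Import Order.TTheory GRing.Theory Num.Theory.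

Local Open Scope classical_set_scope.
Local Open Scope ring_scope.

(** * Polish groups and category *)

(** The group is a subset of an ambient abelian group rather than a type, so
    that solution sets of linear systems in powers of a module can be taken as
    they stand. The metric is a complete one that induces the topology; in
    general it is not translation-invariant. *)
Record polishGroup (K : realType) := PolishGroup {
  pg_sort :> zmodType;
  dist : pg_sort -> pg_sort -> K;
  carrier : set pg_sort;
  distxx : forall x, dist x x = 0;
  dist_eq0 : forall x y, dist x y = 0 -> x = y;
  dist_sym : forall x y, dist x y = dist y x;
  dist_triangle : forall x y z, dist x z <= dist x y + dist y z;
  dist_sub : forall x y (e : K), 0 < e -> exists2 r : K, 0 < r &
    forall x' y', dist x x' < r -> dist y y' < r ->
      dist (x - y) (x' - y') < e;
  carrier0 : carrier 0;
  carrierB : forall x y, carrier x -> carrier y -> carrier (x - y);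
  carrier_complete : forall u : nat -> pg_sort,
    (forall k, carrier (u k)) ->
    (forall e : K, 0 < e -> exists N, forall i j, (N <= i)%N -> (N <= j)%N ->
       dist (u i) (u j) < e) ->
    exists2 l, carrier l &
      forall e : K, 0 < e -> exists N, forall k, (N <= k)%N -> dist (u k) l < e;
  carrier_separable : exists2 D : nat -> pg_sort, forall k, carrier (D k) &
    forall x (e : K), carrier x -> 0 < e -> exists k, dist x (D k) < e
}.

Section PolishGroupTheory.
Variables (K : realType) (G : polishGroup K).
Implicit Types (x y z c : G) (e r : K) (F : set G).

Lemma dist_ge0 x y : 0 <= dist x y.
Proof. by have := dist_triangle x y x; rewrite distxx (dist_sym y x); lra. Qed.

Lemma dist_small x y : (forall e : K, 0 < e -> dist x y < e) -> x = y.
Proof.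
move=> xy; apply: dist_eq0; apply/eqP; rewrite eq_le dist_ge0 andbT leNgt.
by apply/negP => /xy; rewrite ltxx.
Qed.

Lemma carrierN x : carrier x -> carrier (- x).
Proof. by move=> cx; rewrite -sub0r; apply: carrierB => //; exact: carrier0. Qed.

Lemma carrierD x y : carrier x -> carrier y -> carrier (x + y).
Proof. by move=> cx cy; rewrite -[y]opprK; apply/carrierB/carrierN. Qed.

Lemma dist_addr x c e : 0 < e -> exists2 r : K, 0 < r &
  forall x', dist x x' < r -> dist (x + c) (x' + c) < e.
Proof.
move=> e0; have [r r0 xr] := dist_sub x (- c) e0.
by exists r => // x' xx'; have := xr x' (- c) xx'; rewrite !opprK distxx; apply.
Qed.

Definition cball x e : set G := [set u | carrier u /\ dist x u < e].

Definition adherent F z := forall e : K, 0 < e -> exists2 w, F w & dist z w < e.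

Definition nowhere_dense F := forall x (e : K), carrier x -> 0 < e ->
  exists y (r : K), [/\ carrier y, dist x y < e, 0 < r &
    forall z, cball y r z -> ~ F z].

Definition meager F := exists2 E : nat -> set G,
  forall j, nowhere_dense (E j) & F `<=` \bigcup_j E j.

Lemma somewhere_dense F : ~ nowhere_dense F ->
  exists x (e : K), [/\ carrier x, 0 < e & cball x e `<=` adherent F].
Proof.
move=> nF; apply: contrapT => H; apply: nF => x e cx e0.
apply: contrapT => nd; apply: H; exists x, e; split => // z [cz xz] r r0.
apply: contrapT => nw; apply: nd; exists z, r; split => // w [cw zw] Fw.
by apply: nw; exists w.
Qed.

Lemma nowhere_dense0 : nowhere_dense set0.
Proof.
by move=> x e cx e0; exists x, 1; split=> [||//|z _ []] //; rewrite distxx. Qed.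

Lemma nowhere_denseU E F :
  nowhere_dense E -> nowhere_dense F -> nowhere_dense (E `|` F).
Proof.
move=> nE nF x e cx e0; have [y [r [cy xy r0 yE]]] := nE x e cx e0.
pose r' := Num.min (r / 2) (e - dist x y).
have r'0 : 0 < r' by rewrite lt_min; apply/andP; split; lra.
have [r'1 r'2] : r' <= r / 2 /\ r' <= e - dist x y.
  by split; rewrite ge_min lexx ?orbT.
have [z [s [cz yz s0 zF]]] := nF y r' cy r'0.
exists z, (Num.min s (r / 2)); split=> //.
- by have := dist_triangle x y z; lra.
- by rewrite lt_min s0 /=; lra.
- move=> w [cw]; rewrite lt_min => /andP[zs zr] [Ew|]; last exact: zF.
  by apply: (yE w) Ew; split=> //; have := dist_triangle y z w; lra.
Qed.

Lemma nowhere_dense_bigcup (T : eqType) (s : seq T) (E : T -> set G) :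
  (forall i, i \in s -> nowhere_dense (E i)) ->
  nowhere_dense (\bigcup_(i in [set` s]) E i).
Proof.
elim: s => [_|i s IH nE].
  suff -> : \bigcup_(i in [set` [::]]) E i = set0 by exact: nowhere_dense0.
  by rewrite -subset0 => x [i].
suff -> : \bigcup_(j in [set` i :: s]) E j =
          E i `|` \bigcup_(j in [set` s]) E j.
  apply: nowhere_denseU; first by apply: nE; rewrite inE eqxx.
  by apply: IH => j js; apply: nE; rewrite inE js orbT.
apply/seteqP; split=> x.
  by move=> [j /=]; rewrite inE => /orP[/eqP ->|js] Ex; [left|right; exists j].
move=> [Ex|[j /= js Ex]]; first by exists i; rewrite //= inE eqxx.
by exists j; rewrite //= inE js orbT.
Qed.

Lemma nowhere_dense_shift F c :
  carrier c -> nowhere_dense F -> nowhere_dense [set z | F (z + c)].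
Proof.
move=> cc nF x e cx e0; have [r r0 xr] := dist_addr (x + c) (- c) e0.
have [y [s [cy xy s0 yF]]] := nF _ _ (carrierD cx cc) r0.
have [t t0 yt] := dist_addr (y - c) c s0.
exists (y - c), t; split=> //.
- exact: carrierB.
- by have := xr _ xy; rewrite addrK.
- move=> z [cz yz] /=; apply: yF; split; first exact: carrierD.
  by have := yt _ yz; rewrite subrK.
Qed.

(** Convergence criterion for the two constructions by successive
    approximation below, [alternation_image] and [cantor_scheme]. *)
Lemma nested_balls (q : nat -> G) (e : nat -> K) :
  (forall k, carrier (q k)) -> (forall k, 0 < e k) ->
  (forall k, e k.+1 <= k.+1%:R^-1) ->
  (forall k, dist (q k) (q k.+1) + e k.+1 <= e k) ->
  exists l, [/\ carrier l, forall k, dist (q k) l <= e k &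
    forall d : K, 0 < d -> exists N, forall k, (N <= k)%N -> dist (q k) l < d].
Proof.
move=> cq e0 e1 qe.
have nest k j : dist (q k) (q (k + j)%N) + e (k + j)%N <= e k.
  elim: j => [|j IH]; first by rewrite addn0 distxx add0r.
  have := qe (k + j)%N; have := dist_triangle (q k) (q (k + j)%N) (q (k + j).+1).
  by rewrite addnS; lra.
have cauchy d : 0 < d -> exists N, forall i j, (N <= i)%N -> (N <= j)%N ->
    dist (q i) (q j) < d.
  move=> d0; have [N] : exists N, e N < d / 2.
    have d20 : 0 < d / 2 by lra.
    have := near_infty_natSinv_lt (PosNum d20).
    by move=> [N _ /(_ N (leqnn N)) /= Nd]; exists N.+1; apply: le_lt_trans Nd.
  move=> Nd; exists N => i j /subnKC <- /subnKC <-.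
  have := nest N (i - N)%N; have := nest N (j - N)%N.
  have := dist_triangle (q (N + (i - N))%N) (q N) (q (N + (j - N))%N).
  rewrite (dist_sym _ (q N)); have := e0 (N + (i - N))%N.
  by have := e0 (N + (j - N))%N; lra.
have [l cl ql] := carrier_complete cq cauchy.
exists l; split=> // k; rewrite leNgt; apply/negP => kl.
have /ql[N Nl] : 0 < dist (q k) l - e k by lra.
have := Nl _ (leq_addl k N); have := dist_triangle (q k) (q (k + N)%N) l.
by have := nest k N; have := e0 (k + N)%N; lra.
Qed.

End PolishGroupTheory.

(** * The image of a Polish group: meager or of countable index *)

Section OpenMapping.
Variables (K : realType) (G H : polishGroup K) (f : G -> H).
Implicit Types (e r d : K).
Hypothesis fB : forall x y, f (x - y) = f x - f y.
Hypothesis f_carrier : forall x, carrier x -> carrier (f x).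
Hypothesis f_cont : forall x (e : K), 0 < e -> exists2 r : K, 0 < r &
  forall x', dist x x' < r -> dist (f x) (f x') < e.

Section SomewhereDense.
Hypothesis f_dense : forall e : K, 0 < e -> ~ nowhere_dense (f @` cball 0 e).

(** If the image of a small ball around 0 is dense in some ball, then
    subtracting from that image one of its own points in that ball makes it
    dense near 0. Translating by [q] gives density near [f q]. *)
Lemma image_cball_adherent q e : carrier q -> 0 < e -> exists2 r : K, 0 < r &
  cball (f q) r `<=` adherent (f @` cball q e).
Proof.
move=> cq e0; have [r1 r10 qr1] := dist_sub q 0 e0.
have [r2 r20 sub0] := dist_sub (0 : G) 0 r10.
have [y [r [cy r0 yr]]] := somewhere_dense (f_dense r20).
have [|_ [u [cu u2] <-] yu] := yr y _ r r0; first by split; rewrite ?distxx.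
have s0 : 0 < r - dist y (f u) by lra.
have [s s1 qs] := dist_addr (f q) (f u - f q) s0.
exists s => // z [cz /qs]; rewrite addrC subrK => zs d d0.
have [t t0 zt] := dist_addr (z + (f u - f q)) (- (f u - f q)) d0.
have [|_ [v [cv v2] <-] zv] := yr (z + (f u - f q)) _ t t0.
  split; first by apply: carrierD => //; apply: carrierB; exact: f_carrier.
  by have := dist_triangle y (f u) (z + (f u - f q)); lra.
have fE : f v - (f u - f q) = f (q - (u - v)).
  by rewrite !fB !opprB addrCA.
exists (f (q - (u - v))); last by have := zt _ zv; rewrite addrK fE.
exists (q - (u - v)) => //; split; first by do 2?apply: carrierB.
have := qr1 q (u - v); rewrite distxx subr0; apply=> //.
by have := sub0 u v u2 v2; rewrite subr0.
Qed.

(** The metric is not invariant, so [y] cannot be reached by adding small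
    corrections to a single approximate preimage: the radius allowed for the
    next correction would depend on the point to which it leads. Instead, [y]
    is obtained as a difference [f p - f q], where [q] and [p] are refined
    alternately. At each stage there is a ball of the target in which the image
    of the current ball around [q] and the image, translated by [- y], of the
    current ball around [p] are both dense. *)
Definition alternation y q e p e' r := [/\ carrier q, carrier p,
  [/\ 0 < e, 0 < e' & 0 < r] &
  forall z, cball (f p - y) r z ->
    adherent (f @` cball q e) z /\ adherent (f @` cball p e') (z + y)].

Lemma alternation_step y q e p e' r d :
  carrier y -> 0 < d -> alternation y q e p e' r ->
  exists q1 e1 p1 e1' r1, [/\ alternation y q1 e1 p1 e1' r1,
    e1 <= d /\ e1' <= d,
    dist q q1 + e1 <= e, dist p p1 + e1' <= e' &
    dist (f p1 - y) (f q1) < d].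
Proof.
move=> cy d0 [cq cp [e0 e'0 r0] zr].
have shrink (a b : K) : a < b -> exists c, [/\ 0 < c, c <= d & a + c <= b].
  move=> ab; exists (Num.min d (b - a)); rewrite lt_min d0 subr_gt0 ab.
  by rewrite ge_min lexx; split=> //; rewrite -lerBrDl ge_min lexx orbT.
have cfpy : carrier (f p - y) by apply: carrierB => //; exact: f_carrier.
(* The point q moves into the common ball; p then follows it. *)
have [|] := zr (f p - y); first by split; rewrite ?distxx.
move=> /(_ r r0)[_ [q1 [cq1 qq1] <-] pq1] _.
have [e1 [e10 e1d qe1]] := shrink _ _ qq1.
have [s1 s10 q1s] := image_cball_adherent cq1 e10.
pose s := Num.min s1 (Num.min d (r - dist (f p - y) (f q1))).
have s0 : 0 < s by rewrite !lt_min s10 d0 subr_gt0.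
have [ss1 sd sr] : [/\ s <= s1, s <= d & s <= r - dist (f p - y) (f q1)].
  by split; rewrite !ge_min lexx ?orbT.
have cfq1 : carrier (f q1) by exact: f_carrier.
have [|_] := zr (f q1); first by split.
have [t t0 q1t] := dist_addr (f q1 + y) (- y) s0.
move=> /(_ t t0)[_ [p1 [cp1 pp1] <-] /q1t]; rewrite addrK => q1p1.
have [e1' [e1'0 e1'd pe1']] := shrink _ _ pp1.
have [s' s'0 p1s] := image_cball_adherent cp1 e1'0.
have [t' t'0 p1t] := dist_addr (f p1 - y) y s'0.
pose r1 := Num.min t' (s - dist (f q1) (f p1 - y)).
exists q1, e1, p1, e1', r1; split=> //; last by rewrite dist_sym; lra.
split=> //; first by split=> //; rewrite lt_min t'0 subr_gt0.
move=> z [cz]; rewrite lt_min => /andP[zt' zs]; split.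
  apply: q1s; split=> //.
  by have := dist_triangle (f q1) (f p1 - y) z; lra.
apply: p1s; split; first exact: carrierD.
by have := p1t _ zt'; rewrite subrK.
Qed.

Lemma alternation_image y q e p e' r : carrier y -> alternation y q e p e' r ->
  (f @` @carrier K G) y.
Proof.
move=> cy c0.
(* Dependent choice over stages (q, e, (p, e'), r). *)
pose inv (st : G * K * (G * K) * K) := 
  let: (q, e, (p, e'), r) := st in alternation y q e p e' r.
pose good k (st st1 : G * K * (G * K) * K) :=
  let: (q, e, (p, e'), r) := st in
  let: (q1, e1, (p1, e1'), r1) := st1 in
  [/\ alternation y q1 e1 p1 e1' r1,
    e1 <= k.+1%:R^-1 /\ e1' <= k.+1%:R^-1,
    dist q q1 + e1 <= e, dist p p1 + e1' <= e' &
    dist (f p1 - y) (f q1) < k.+1%:R^-1].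
have /choice[nxt nxtP] (x : nat * (G * K * (G * K) * K)) :
    exists st1, inv x.2 -> good x.1 x.2 st1.
  case: x => k [[[q' d] [p' d']] s].
  have [c|nc] := pselect (alternation y q' d p' d' s); last first.
    by exists (q', d, (p', d'), s).
  have k0 : 0 < k.+1%:R^-1 :> K by rewrite invr_gt0.
  have [q1 [e1 [p1 [e1' [r1 ?]]]]] := alternation_step cy k0 c.
  by exists (q1, e1, (p1, e1'), r1).
pose st := fix st k := if k is k'.+1 then nxt (k', st k') else (q, e, (p, e'), r).
have invS s t k : inv s -> good k s t -> inv t.
  by case: s t => [[[? ?] [? ?]] ?] [[[? ?] [? ?]] ?] _ [].
have stP k : inv (st k).
  by elim: k => // k IH; apply: (invS _ _ k IH); exact: (nxtP (k, st k) IH).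
have goodP k : good k (st k) (st k.+1) by exact: (nxtP (k, st k) (stP k)).
pose qs k := (st k).1.1.1; pose es k := (st k).1.1.2.
pose ps k := (st k).1.2.1; pose es' k := (st k).1.2.2.
have I k : [/\ carrier (qs k), carrier (ps k), 0 < es k & 0 < es' k].
  have := stP k; rewrite /qs /ps /es /es'.
  by case: (st k) => [[[? ?] [? ?]] ?] [? ? []].
have S k : [/\ es k.+1 <= k.+1%:R^-1, es' k.+1 <= k.+1%:R^-1,
    dist (qs k) (qs k.+1) + es k.+1 <= es k,
    dist (ps k) (ps k.+1) + es' k.+1 <= es' k &
    dist (f (ps k.+1) - y) (f (qs k.+1)) < k.+1%:R^-1].
  have := goodP k; rewrite /qs /ps /es /es' /good.
  case: (st k) => [[[? ?] [? ?]] ?]; case: (st k.+1) => [[[? ?] [? ?]] ?] /=.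
  by move=> [_ []].
have [|k|k|k|a [ca _ qa]] := @nested_balls _ _ qs es.
- by move=> k; have [] := I k.
- by have [] := I k.
- by have [] := S k.
- by have [] := S k.
have [|k|k|k|b [cb _ pb]] := @nested_balls _ _ ps es'.
- by move=> k; have [] := I k.
- by have [] := I k.
- by have [] := S k.
- by have [] := S k.
exists (b - a); first exact: carrierB.
suff E : f b - y = f a by rewrite fB -E subKr.
apply: dist_small => d d0; have d30 : 0 < d / 3 by lra.
have [r1 r10 fbr] := dist_addr (f b) (- y) d30.
have [r2 r20 br] := f_cont b r10; have [r3 r30 ar] := f_cont a d30.
have [N1 bN] := pb _ r20; have [N2 aN] := qa _ r30.
have [N3 _ N3d] := near_infty_natSinv_lt (PosNum d30).
pose N := (N1 + N2 + N3).+1.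
have /aN : (N2 <= N)%N by rewrite /N; lia.
have /bN : (N1 <= N)%N by rewrite /N; lia.
rewrite dist_sym => /br/fbr bd; rewrite dist_sym => /ar.
have [_ _ _ _] := S (N1 + N2 + N3)%N; rewrite -/N.
have := N3d (N1 + N2 + N3)%N (leq_addl _ _); rewrite /= -/N.
have := dist_triangle (f b - y) (f (ps N) - y) (f a).
have := dist_triangle (f (ps N) - y) (f (qs N)) (f a).
by rewrite (dist_sym (f (qs N))); lra.
Qed.

Lemma image_open : exists2 r : K, 0 < r & cball 0 r `<=` f @` @carrier K G.
Proof.
have c0 := carrier0 G; have f0 : f 0 = 0 by rewrite -(subrr 0) fB subrr.
have [r r0] := image_cball_adherent c0 ltr01.
rewrite f0 => adh; exists (r / 2); first by lra.
move=> y [cy y0]; suff [x cx fx] : (f @` @carrier K G) (- y).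
  by exists (- x); [exact: carrierN|rewrite -sub0r fB f0 fx sub0r opprK].
have [s s0 ys] := dist_addr y (- y) r0.
have r20 : 0 < r / 2 by lra.
apply: (@alternation_image (- y) 0 1 0 1 (Num.min (r / 2) s)); first exact: carrierN.
split=> //; first by rewrite lt_min r20 s0.
move=> z [cz]; rewrite lt_min f0 sub0r opprK => /andP[zr zs]; split; apply: adh.
  by split=> //; have := dist_triangle 0 y z; lra.
split; first by apply: carrierB.
by have := ys _ zs; rewrite subrr.
Qed.

End SomewhereDense.

(** Either the image of some ball around 0 is nowhere dense, and then
    countably many of its translates cover the image of [G]; or the image is an
    open subgroup, which has countable index in a separable group. *)
Lemma image_meager_or_countable_index :
  meager (f @` @carrier K G) \/
  exists2 c : nat -> H, forall k, carrier (c k) &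
    forall y, carrier y -> exists k, (f @` @carrier K G) (y - c k).
Proof.
have [[e [e0 nd]]|H0] :=
    pselect (exists e, 0 < e /\ nowhere_dense (f @` cball 0 e)).
  left; have [D cD Dd] := carrier_separable G.
  exists (fun k => [set z | (f @` cball 0 e) (z + - f (D k))]).
    by move=> k; apply: nowhere_dense_shift => //; apply/carrierN/f_carrier.
  move=> _ [x cx <-]; have [r r0 xr] := dist_sub x x e0.
  have [k xk] := Dd x r cx r0; exists k => //=; rewrite -fB.
  exists (x - D k) => //; split; first exact: carrierB.
  by have := xr x (D k); rewrite subrr distxx; apply.
right; have [|r r0 fr] := image_open; first by move=> e e0 nd; apply: H0; exists e.
have [D cD Dd] := carrier_separable H; exists D => // y cy.
have [s s0 ys] := dist_sub y y r0; have [k yk] := Dd y s cy s0.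
exists k; apply: fr; split; first exact: carrierB.
by have := ys y (D k); rewrite subrr distxx; apply.
Qed.

End OpenMapping.

(** * Many elements that differ modulo a meager set *)

Lemma finite_radius (K : realType) (T : eqType) (s : seq T)
    (P : T -> K -> Prop) :
  (forall c, c \in s -> exists2 r : K, 0 < r &
     forall t, 0 < t -> t <= r -> P c t) ->
  exists2 r : K, 0 < r & forall t c, 0 < t -> t <= r -> c \in s -> P c t.
Proof.
elim: s => [_|c s IH sP]; first by exists 1.
have [|r r0 rP] := IH; first by move=> c' c's; apply: sP; rewrite inE c's orbT.
have [r' r'0 r'P] := sP c (mem_head _ _).
exists (Num.min r r'); first by rewrite lt_min r0.
move=> t c' t0; rewrite le_min inE => /andP[tr tr'] /orP[/eqP ->|c's].
  exact: r'P.
exact: rP.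
Qed.

Section CantorScheme.
Variables (K : realType) (G : polishGroup K).
Implicit Types (x y u v a b : G) (e r d t : K).

(** The finitely many closeness conditions on [x] hold for all small [x],
    while the conditions that [u + x - v] avoids [E i] exclude a nowhere dense
    set. The radius [r] then keeps these conditions true under perturbation of
    [u + x] and [v]. *)
Lemma generic_increment (E : nat -> set G) (s : seq G) k e d :
  (forall i, nowhere_dense (E i)) -> (forall u, u \in s -> carrier u) ->
  0 < e -> 0 < d ->
  exists x r, [/\ carrier x, 0 < r, r <= d,
    forall u, u \in s -> dist u (u + x) + r <= e &
    forall u v a b i, u \in s -> v \in s -> (i <= k)%N ->
      carrier a -> carrier b -> dist (u + x) a <= r -> dist v b <= r ->
      ~ E i (a - b)].
Proof.
move=> Ed cs e0 d0.
have [|r0 r00 sr0] := @finite_radius K _ s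
    (fun u r => forall x, dist 0 x < r -> dist u (u + x) < e).
  move=> u us; have [r r0 ur] := dist_addr 0 u e0; exists r => // t t0 tr x xt.
  by have := ur x (lt_le_trans xt tr); rewrite add0r addrC.
pose l := [seq (c, i) | c <- [seq (u, v) | u <- s, v <- s], i <- iota 0 k.+1].
have : nowhere_dense
    (\bigcup_(c in [set` l]) [set z | E c.2 (z + (c.1.1 - c.1.2))]).
  apply: nowhere_dense_bigcup => c cl.
  apply: nowhere_dense_shift; last exact: Ed.
  move: cl => /allpairsP[[c' i] /= [/allpairsP[[u v] /= [us vs ->]] _ ->]] /=.
  by apply: carrierB; exact: cs.
move=> /(_ 0 (Num.min r0 1) (carrier0 G)); rewrite lt_min r00 ltr01.
move=> /(_ isT)[x [r1 [cx]]]; rewrite lt_min => /andP[x0 _] r10 xE.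
have [|r2 r20 sr2] := @finite_radius K _ s (fun u r => dist u (u + x) + r <= e).
  move=> u us; exists (e - dist u (u + x)).
    by rewrite subr_gt0; apply: (sr0 _ _ r00 (lexx _) us).
  by move=> t _; rewrite -lerBrDl.
have [|r3 r30 sr3] := @finite_radius K _ [seq (u, v) | u <- s, v <- s]
    (fun c r => forall a b, dist (c.1 + x) a <= r -> dist c.2 b <= r ->
       dist x (a - b - (c.1 - c.2)) < r1).
  move=> _ /allpairsP[[u v] /= [us vs ->]].
  have [t t0 xt] := dist_addr (u + x - v) (- (u - v)) r10.
  have [t' t'0 uvt] := dist_sub (u + x) v t0.
  exists (t' / 2) => [|t'' t''0 tt' a b /= xa vb]; first by lra.
  suff {1}-> : x = u + x - v - (u - v) by apply/xt/uvt; lra.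
  by rewrite opprB addrA subrK addrAC subrr add0r.
exists x, (Num.min d (Num.min r2 r3)).
set r := Num.min d _; have r_gt0 : 0 < r by rewrite !lt_min d0 r20.
have [rd r2r r3r] : [/\ r <= d, r <= r2 & r <= r3].
  by split; rewrite !ge_min lexx ?orbT.
split=> // [u us|u v a b i us vs ik ca cb xa vb Eab]; first exact: sr2.
apply: (xE (a - b - (u - v))).
  split; first by apply: carrierB; apply: carrierB => //; exact: cs.
  by apply: (sr3 r (u, v)) => //; apply: allpairs_f.
exists ((u, v), i); last by rewrite /= subrK.
by apply: allpairs_f; [exact: allpairs_f|rewrite mem_iota].
Qed.

(** The element attached to [h] is the infinite sum of the increments [x k]
    over all [k] such that [h (logn 2 k)] holds. If [h m] and [~~ h' m], then
    [h] takes and [h'] omits the increment [x k] at each of the infinitely many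
    [k] with [logn 2 k = m]. The difference of the two sums avoids [E i] by the
    choice of [x k] at any such [k >= i]. *)
Theorem cantor_scheme (F : set G) : meager F ->
  exists2 X : (nat -> bool) -> G, forall h, carrier (X h) &
    forall h h' : nat -> bool, (exists2 m, h m & ~~ h' m) -> ~ F (X h - X h').
Proof.
move=> [E Ed FE].
pose inv (st : seq G * K) := (forall u, u \in st.1 -> carrier u) /\ 0 < st.2.
have /choice[nxt nxtP] (p : nat * (seq G * K)) : exists xr : G * K, inv p.2 ->
    [/\ carrier xr.1, 0 < xr.2, xr.2 <= p.1.+1%:R^-1,
    forall u, u \in p.2.1 -> dist u (u + xr.1) + xr.2 <= p.2.2 &
    forall u v a b i, u \in p.2.1 -> v \in p.2.1 -> (i <= p.1)%N ->
      carrier a -> carrier b -> dist (u + xr.1) a <= xr.2 ->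
      dist v b <= xr.2 -> ~ E i (a - b)].
  case: p => k [s e]; have [[/= cs e0]|?] := pselect (inv (s, e)); last first.
    by exists (0, 0).
  have k0 : 0 < k.+1%:R^-1 :> K by rewrite invr_gt0.
  have [x [r ?]] := generic_increment k Ed cs e0 k0.
  by exists (x, r).
(* st k lists all sums of increments of index below k, with a common radius. *)
pose st := fix st k : seq G * K := if k is k'.+1 then
  let: xr := nxt (k', st k') in ((st k').1 ++ [seq u + xr.1 | u <- (st k').1], xr.2)
  else ([:: 0], 1).
have stP k : inv (st k).
  elim: k => [|k IH]; first by split=> // u; rewrite inE => /eqP ->; exact: carrier0.
  have [cx r0 _ _ _] := nxtP (k, st k) IH; split=> //= u.
  rewrite mem_cat => /orP[us|/mapP[v vs ->]]; first exact: IH.1.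
  by apply: carrierD => //; exact: IH.1.
pose x k := (nxt (k, st k)).1; pose r k := (st k).2.
pose sum h := fix sum k : G := if k is k'.+1 then
  (if h (logn 2 k') then sum k' + x k' else sum k') else 0.
have sumS h k : sum h k \in (st k).1.
  elim: k => [|k IH]; first by rewrite inE.
  rewrite /= mem_cat; case: ifP => _; last by rewrite IH.
  by apply/orP; right; apply/mapP; exists (sum h k).
have cvg h : exists l, carrier l /\ forall k, dist (sum h k) l <= r k.
  have [k|k|k|k|l [cl kl _]] := @nested_balls _ _ (sum h) r.
  - exact: (stP k).1.
  - exact: (stP k).2.
  - by have [] := nxtP (k, st k) (stP k).
  - have [_ r0 _ /(_ _ (sumS h k)) sr _] := nxtP (k, st k) (stP k).
    rewrite /=; case: ifP => // _; rewrite distxx add0r.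
    by apply: le_trans sr; rewrite lerDr dist_ge0.
  - by exists l.
have [X XP] := choice cvg; exists X => [h|h h' [m hm h'm] /FE[i _]].
  exact: (XP h).1.
(* An index beyond i at which the m-th digit is read. *)
pose k := (2 ^ m * i.*2.+1)%N.
have km : logn 2 k = m.
  rewrite lognM ?expn_gt0 // pfactorK // -[RHS]addn0; congr addn.
  by rewrite lognE /= dvdn2 /= odd_double.
have ik : (i <= k)%N.
  rewrite /k (@leq_trans i.*2.+1) //; first by rewrite -addnn; lia.
  by rewrite leq_pmull // expn_gt0.
have [_ _ _ _ avoid] := nxtP (k, st k) (stP k).
apply: (avoid (sum h k) (sum h' k)) => //.
- exact: (XP h).1.
- exact: (XP h').1.
- by have := (XP h).2 k.+1; rewrite /= km hm.
- by have := (XP h').2 k.+1; rewrite /= km (negbTE h'm).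
Qed.

Lemma meager_bigcup (F : nat -> set G) :
  (forall i, meager (F i)) -> meager (\bigcup_i F i).
Proof.
move=> mF; have /choice[E EP] i : exists E : nat -> set G,
    (forall j, nowhere_dense (E j)) /\ F i `<=` \bigcup_j E j.
  by have [E ? ?] := mF i; exists E.
exists (fun n => if unpickle n is Some (i, j) then E i j else set0).
  move=> n; case: unpickle => [[i j]|]; first exact: (EP i).1.
  exact: nowhere_dense0.
move=> y [i _ /(EP i).2[j _ Ey]].
by exists (pickle (i, j)); rewrite //= pickleK.
Qed.

End CantorScheme.

(** * Positive-primitive formulae and the consistency hypothesis *)

Section PositivePrimitiveSolutions.
Variable R : nzRingType.

Definition linear_solutions (M : lmodType R) k n (C : 'M[R]_(k, n)) :
    set ('I_n -> M) :=
  [set w | forall i, \sum_j C i j *: w j = 0].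

Lemma sat_linear_system (M : lmodType R) k n (C : 'M[R]_(k, n))
    (w : 'I_n -> M) :
  sat (linear_system C) w <-> linear_solutions C w.
Proof.
have evalE (T : Type) (s : seq T) (F : T -> term R n) :
    eval_term (\big[@TAdd R n/TZero]_(j <- s) F j) w = \sum_(j <- s) eval_term (F j) w.
  by elim/big_rec2: _ => //= j y x _ ->.
have satE (T : eqType) (s : seq T) (F : T -> formula R n) :
    sat (\big[@FAnd R n/FTrue]_(j <- s) F j) w <-> forall j, j \in s -> sat (F j) w.
  elim: s => [|j s IH]; first by rewrite big_nil; split.
  rewrite big_cons /= IH; split=> [[Fj Fs] i|Fs].
    by rewrite inE => /orP[/eqP ->|/Fs].
  by split=> [|i si]; apply: Fs; rewrite inE ?eqxx // si orbT.
rewrite /linear_system satE; split=> [H i|H i _].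
  by have := H i (mem_index_enum i); rewrite /= evalE.
by rewrite /= evalE; exact: H.
Qed.

Lemma extendK (T : Type) n (w : 'I_n.+1 -> T) :
  extend (w ord0) (fun j => w (lift ord0 j)) = w.
Proof. by apply/funext => i; rewrite /extend; case: unliftP => [j|] ->. Qed.

Lemma sat_exists_block (M : lmodType R) m n (f : formula R (m + n))
    (v : 'I_n -> M) :
  sat (exists_block f) v <->
  exists w : 'I_(m + n) -> M, sat f w /\ (fun j => w (rshift m j)) = v.
Proof.
elim: m f => [|m IH] f /=.
  have rE (w : 'I_n -> M) : (fun j => w (rshift 0 j)) = w.
    by apply/funext => j; congr w; apply: val_inj.
  by split=> [fv|[w [fw]]]; [exists v; rewrite rE | rewrite rE => <-].
have shiftE (w : 'I_(m + n).+1 -> M) j :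
    w (rshift m.+1 j) = w (lift ord0 (rshift m j)).
  by congr w; apply: val_inj; rewrite /= /bump leq0n.
rewrite IH; split=> [[w [[x fx] <-]]|[w [fw <-]]].
  exists (extend x w); split=> //; apply/funext => j.
  by rewrite shiftE /extend liftK.
exists (fun j => w (lift ord0 j)); split; last by apply/funext => j; rewrite shiftE.
by exists (w ord0); rewrite extendK.
Qed.

(** A pp-definable set is the projection of the solution set of a linear
    system: this semantic form is what the rest of the proof manipulates. *)
Lemma is_ppP n (f : formula R n) : is_pp f <->
  exists m k (C : 'M[R]_(k, m + n)), forall (M : lmodType R) (v : 'I_n -> M),
    sat f v <->
    exists w : 'I_(m + n) -> M,
      linear_solutions C w /\ (fun j => w (rshift m j)) = v.
Proof.
by split=> -[m [k [C fC]]]; exists m, k, C => M v; rewrite fC sat_exists_block;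
  split=> -[w [Cw <-]]; exists w; split=> //; apply/sat_linear_system.
Qed.

(** The two systems are put in one block matrix, with disjoint sets of bound
    variables and the same free variables. *)
Lemma is_pp_and n (f g : formula R n) : is_pp f -> is_pp g -> is_pp (FAnd f g).
Proof.
move=> /is_ppP[m [k [C fC]]] /is_ppP[p [l [D gD]]]; apply/is_ppP.
pose E : 'M[R]_(k + l, (m + p) + n) :=
  col_mx (row_mx (row_mx (lsubmx C) 0) (rsubmx C))
         (row_mx (row_mx 0 (lsubmx D)) (rsubmx D)).
have splitl q r (i : 'I_q) : fintype.split (lshift r i) = inl i.
  exact: (unsplitK (inl i)).
have splitr q r (i : 'I_r) : fintype.split (rshift q i) = inr i.
  exact: (unsplitK (inr i)).
pose wC (M : lmodType R) (w : 'I_(m + p + n) -> M) (i : 'I_(m + n)) :=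
  match fintype.split i with
  | inl a => w (lshift n (lshift p a)) | inr b => w (rshift (m + p) b) end.
pose wD (M : lmodType R) (w : 'I_(m + p + n) -> M) (i : 'I_(p + n)) :=
  match fintype.split i with
  | inl a => w (lshift n (rshift m a)) | inr b => w (rshift (m + p) b) end.
have EE (M : lmodType R) (w : 'I_(m + p + n) -> M) :
    linear_solutions E w <-> linear_solutions C (wC M w) /\
                             linear_solutions D (wD M w).
  have sumC i : \sum_j E (lshift l i) j *: w j = \sum_j C i j *: wC M w j.
    rewrite !big_split_ord /= [X in _ + X + _]big1 ?addr0; last first.
      by move=> j _; rewrite col_mxEu row_mxEl row_mxEr mxE scale0r.
    congr (_ + _); apply: eq_bigr => j _; rewrite col_mxEu /wC.
      by rewrite !row_mxEl mxE splitl.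
    by rewrite row_mxEr mxE splitr.
  have sumD i : \sum_j E (rshift k i) j *: w j = \sum_j D i j *: wD M w j.
    rewrite !big_split_ord /= [X in X + _ + _]big1 ?add0r; last first.
      by move=> j _; rewrite col_mxEd !row_mxEl mxE scale0r.
    congr (_ + _); apply: eq_bigr => j _; rewrite col_mxEd /wD.
      by rewrite row_mxEl row_mxEr mxE splitl.
    by rewrite row_mxEr mxE splitr.
  split=> [H|[HC HD] i]; first by split=> i; rewrite -?sumC -?sumD; apply: H.
  by case: (split_ordP i) => j ->; rewrite ?sumC ?sumD; [apply: HC|apply: HD].
exists (m + p)%N, (k + l)%N, E => M v; rewrite /= fC gD.
split=> [[[a [Ca av]] [b [Db bv]]]|[w [/EE[Cw Dw] wv]]]; last first.
  by split; [exists (wC M w)|exists (wD M w)]; split=> //; rewrite -wv;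
    apply/funext => j; rewrite /wC /wD splitr.
pose w (i : 'I_(m + p + n)) := match fintype.split i with
  | inl c => match fintype.split c with
             | inl i => a (lshift n i) | inr i => b (lshift n i) end
  | inr j => v j end.
exists w; split; last by apply/funext => j; rewrite /w splitr.
apply/EE; split.
  suff -> : wC M w = a by [].
  apply/funext => i; rewrite /wC /w; case: (split_ordP i) => j ->.
    by rewrite !splitl.
  by rewrite !splitr -av.
suff -> : wD M w = b by [].
apply/funext => i; rewrite /wD /w; case: (split_ordP i) => j ->.
  by rewrite !splitl splitr.
by rewrite !splitr -bv.
Qed.

Lemma linear_solutionsB (M : lmodType R) k n (C : 'M[R]_(k, n))
    (w w' : 'I_n -> M) :
  linear_solutions C w -> linear_solutions C w' -> linear_solutions C (w - w').
Proof.
move=> Cw Cw' i; under eq_bigr do rewrite scalerBr.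
by rewrite sumrB Cw Cw' subrr.
Qed.

Lemma linear_solutions0 (M : lmodType R) k n (C : 'M[R]_(k, n)) :
  @linear_solutions M k n C 0.
Proof. by move=> i; rewrite big1 // => j _; rewrite scaler0. Qed.

Lemma is_ppB (M : lmodType R) n (f : formula R n) : is_pp f ->
  forall u v, solset M f u -> solset M f v -> solset M f (u - v).
Proof.
move=> /is_ppP[m [k [C fC]]] u v /fC[a [Ca <-]] /fC[b [Cb <-]].
by apply/fC; exists (a - b); split=> //; exact: linear_solutionsB.
Qed.

Lemma is_pp0 (M : lmodType R) n (f : formula R n) : is_pp f -> solset M f 0.
Proof.
by move=> /is_ppP[m [k [C fC]]]; apply/fC; exists 0; split=> //; exact: linear_solutions0.
Qed.

End PositivePrimitiveSolutions.

Section Cosets.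
Variable V : zmodType.
Implicit Types (H L : set V) (u v : V).

Lemma coset_eqB L u v : L 0 ->
  [set u + y | y in L] = [set v + y | y in L] -> L (u - v).
Proof.
move=> L0 /seteqP[uv _]; have [|y Ly <-] := uv u; first by exists 0; rewrite ?addr0.
by rewrite addrC addKr.
Qed.

Lemma coset_eq L u v : L 0 -> (forall x y, L x -> L y -> L (x - y)) ->
  L (u - v) -> [set u + y | y in L] = [set v + y | y in L].
Proof.
move=> L0 LB Luv; have LN x : L x -> L (- x) by rewrite -sub0r; exact: LB.
have LD x y : L x -> L y -> L (x + y).
  by move=> Lx Ly; rewrite -[y]opprK; apply/LB/LN.
apply/seteqP; split=> _ [y Ly <-].
  by exists (u - v + y); [exact: LD|rewrite addrA subrKC].
exists (y - (u - v)); first exact: LB.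
by rewrite opprB addrCA subrKC addrC.
Qed.

Lemma cosets_eq1 H L : L 0 -> H 0 ->
  (cosets H L #= `I_1)%card -> H `<=` L.
Proof.
move=> L0 H0 /card_set_bijP[f [fI f_inj _]] u Hu; rewrite -[u]subr0.
have cu : cosets H L [set u + y | y in L] by exists u.
have c0 : cosets H L [set 0 + y | y in L] by exists 0.
apply: (coset_eqB L0); apply: f_inj; rewrite ?inE //.
by move: (fI _ cu) (fI _ c0); rewrite /= !ltnS !leqn0 => /eqP -> /eqP ->.
Qed.

End Cosets.

Section Consistency.
Variable R : nzRingType.

Fixpoint forall_closure n : formula R n -> formula R 0 :=
  match n with
  | 0%N => id
  | _.+1 => fun f => forall_closure (FAll f)
  end.

Lemma holds_forall_closure (M : lmodType R) n (f : formula R n) :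
  holds M (forall_closure f) <-> forall v : 'I_n -> M, sat f v.
Proof.
elim: n f => [|n IH] f //=; rewrite IH /=; split=> [H v|H v x]; last exact: H.
by rewrite -[v]extendK; exact: H.
Qed.

(** If the index were countable in [A], it would be 1 in every module that
    obeys the prescription, so the sentence saying that [phi] implies [psi i]
    would belong to [Th_Pun A] and no realization of the type could exist. *)
Lemma uncountable_index (A : lmodType R) n (phi : formula R n)
    (psi : nat -> formula R n) i :
  is_pp phi -> is_pp (psi i) -> solset A (psi i) `<=` solset A phi ->
  consistent (Th_Pun A) (pp_type phi psi) ->
  ~ countable (cosets (solset A phi) (solset A (psi i))).
Proof.
move=> pp_phi pp_psi psi_phi [M [MT [u qu]]] cA.
have pair : is_pp_pair phi (FAnd phi (psi i)).
  by split=> //; [exact: is_pp_and|move=> N v []].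
have : Th_Pun A (forall_closure (FImp phi (psi i))).
  move=> N /(_ n _ _ pair)[_ N1]; apply/holds_forall_closure => v /= phi_v.
  have c0 : solset N (FAnd phi (psi i)) 0 by split; exact: is_pp0.
  apply: (cosets_eq1 c0 (is_pp0 N pp_phi) (N1 _) phi_v).2.
  suff -> : solset A (FAnd phi (psi i)) = solset A (psi i) by [].
  by apply/seteqP; split=> [v' []|v' psi_v'] //; split=> //; exact: psi_phi.
move=> /MT/holds_forall_closure/(_ u) /=.
have /= nu : sat (FNot (psi i)) u by apply: qu; right; exists i.
by move=> H; apply/nu/H/qu; left.
Qed.

End Consistency.

(** * Solution groups in powers of a Polish module *)

Section PowerSubgroup.
Variables (K : realType) (G : polishGroup K) (I : finType) (S : set (I -> G)).
Hypothesis S_carrier : forall x, S x -> forall i, carrier (x i).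
Hypothesis S0 : S 0.
Hypothesis SB : forall x y, S x -> S y -> S (x - y).
Hypothesis S_closed : forall x, (forall i, carrier (x i)) ->
  (forall e : K, 0 < e -> exists2 y, S y &
     forall i, dist (x i) (y i) < e) -> S x.
Implicit Types (x y z : I -> G) (e r : K).

Definition power_dist x y : K := \sum_i dist (x i) (y i).

Lemma dist_le_power x y i : dist (x i) (y i) <= power_dist x y.
Proof.
by rewrite /power_dist (bigD1 i) //= lerDl sumr_ge0 // => j _; exact: dist_ge0.
Qed.

Lemma power_dist_lt e : 0 < e -> exists2 r : K, 0 < r &
  forall x y, (forall i, dist (x i) (y i) < r) -> power_dist x y < e.
Proof.
move=> e0; have c0 : 0 < #|I|.+1%:R :> K by rewrite ltr0n.
exists (e / #|I|.+1%:R) => [|x y xy]; first exact: divr_gt0.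
have -> : e = \sum_(i : I) (e / #|I|.+1%:R) + e / #|I|.+1%:R.
  by rewrite sumr_const -mulrSr -[RHS]mulr_natr divfK ?gt_eqF.
apply: (@le_lt_trans _ _ (\sum_(i : I) (e / #|I|.+1%:R))).
  by apply: ler_sum => i _; exact: ltW.
by rewrite ltrDl divr_gt0.
Qed.

Lemma power_distxx x : power_dist x x = 0.
Proof. by rewrite /power_dist big1 // => i _; rewrite distxx. Qed.

Lemma power_dist_eq0 x y : power_dist x y = 0 -> x = y.
Proof.
move=> xy; apply/funext => i; apply: dist_eq0; apply/eqP.
by rewrite eq_le dist_ge0 -xy dist_le_power.
Qed.

Lemma power_dist_sym x y : power_dist x y = power_dist y x.
Proof. by apply: eq_bigr => i _; rewrite dist_sym. Qed.

Lemma power_dist_triangle x y z :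
  power_dist x z <= power_dist x y + power_dist y z.
Proof.
by rewrite /power_dist -big_split; apply: ler_sum => i _; exact: dist_triangle.
Qed.

Lemma power_dist_sub x y e : 0 < e -> exists2 r : K, 0 < r &
  forall x' y', power_dist x x' < r -> power_dist y y' < r ->
    power_dist (x - y) (x' - y') < e.
Proof.
move=> e0; have [r r0 re] := power_dist_lt e0.
have [|t t0 tP] := @finite_radius K I (enum I) (fun i t => forall a b,
    dist (x i) a < t -> dist (y i) b < t -> dist (x i - y i) (a - b) < r).
  move=> i _; have [t t0 ti] := dist_sub (x i) (y i) r0; exists t => //.
  by move=> t' _ tt' a b xa yb; apply: ti; apply: lt_le_trans tt'.
exists t => // x' y' xx' yy'; apply: re => i.
apply: (tP t i) => //; first exact: mem_enum.
  by apply: le_lt_trans xx'; exact: dist_le_power.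
by apply: le_lt_trans yy'; exact: dist_le_power.
Qed.

Lemma power_complete (u : nat -> I -> G) : (forall k, S (u k)) ->
  (forall e, 0 < e -> exists N, forall i j, (N <= i)%N -> (N <= j)%N ->
     power_dist (u i) (u j) < e) ->
  exists2 l, S l &
    forall e, 0 < e -> exists N, forall k, (N <= k)%N -> power_dist (u k) l < e.
Proof.
move=> Su cu; have /choice[l lP] i : exists l, carrier l /\ forall e, 0 < e ->
    exists N, forall k, (N <= k)%N -> dist (u k i) l < e.
  have [k|e e0|l cl ul] := @carrier_complete K G (fun k => u k i).
  - exact: S_carrier.
  - have [N Nu] := cu e e0; exists N => a b Na Nb.
    by apply: le_lt_trans (Nu a b Na Nb); exact: dist_le_power.
  - by exists l.
have cvg e : 0 < e -> exists N, forall k, (N <= k)%N -> forall i, dist (u k i) (l i) < e.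
  move=> e0; have /choice[N NP] i := (lP i).2 e e0.
  exists (\max_i N i) => k Nk i; apply: NP; apply: leq_trans Nk.
  exact: leq_bigmax.
exists l => [|e e0].
  apply: S_closed => [i|e /cvg[N NP]]; first exact: (lP i).1.
  by exists (u N) => // i; rewrite dist_sym; exact: NP.
have [r r0 re] := power_dist_lt e0; have [N NP] := cvg r r0.
by exists N => k Nk; apply/re/NP.
Qed.

Lemma power_separable : exists2 D : nat -> I -> G, forall k, S (D k) &
  forall x e, S x -> 0 < e -> exists k, power_dist x (D k) < e.
Proof.
have [D0 cD0 D0x] := carrier_separable G.
(* For a point c of a countable dense subset of the power and a radius
   1 / (k + 1), D picks a point of S in the ball around c if there is one. *)
have /choice[D DP] (n : nat) : exists y, S y /\
    forall (c : {ffun I -> nat}) k, unpickle n = Some (c, k) ->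
    (exists2 z, S z & power_dist (fun i => D0 (c i)) z < k.+1%:R^-1) ->
    power_dist (fun i => D0 (c i)) y < k.+1%:R^-1.
  have [[c [k [z [nck Sz zc]]]]|none] := pselect (exists c : {ffun I -> nat},
    exists k z, [/\ unpickle n = Some (c, k), S z &
      power_dist (fun i => D0 (c i)) z < k.+1%:R^-1]).
    by exists z; split=> // c' k'; rewrite nck => -[<- <-].
  by exists 0; split=> // c k nck [z Sz zc]; case: none; exists c, k, z.
exists D => [k|x e Sx e0]; first exact: (DP k).1.
have e20 : 0 < e / 2 by lra.
have [k _ /(_ k (leqnn k)) /= ke] := near_infty_natSinv_lt (PosNum e20).
have k0 : 0 < k.+1%:R^-1 :> K by rewrite invr_gt0.
have [r r0 rk] := power_dist_lt k0.
have /choice[c cP] i := D0x (x i) r (S_carrier Sx i) r0.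
pose c' := [ffun i => c i]; pose n := pickle (c', k).
have xc : power_dist x (fun i => D0 (c' i)) < k.+1%:R^-1.
  by apply: rk => i; rewrite ffunE.
exists n; apply: le_lt_trans (power_dist_triangle _ (fun i => D0 (c' i)) _) _.
rewrite (splitr e); apply: ltrD; first exact: lt_trans ke.
have : power_dist (fun i => D0 (c' i)) (D n) < k.+1%:R^-1.
  by apply: (DP n).2; [rewrite pickleK|exists x => //; rewrite power_dist_sym].
by move/lt_trans; apply.
Qed.

Definition power_subgroup : polishGroup K := @PolishGroup K
  (I -> G) power_dist S power_distxx power_dist_eq0 power_dist_sym
  power_dist_triangle power_dist_sub S0 SB power_complete power_separable.

End PowerSubgroup.

Section PolishModule.
Variables (K : realType) (R : nzRingType) (A : topModType R) (d : A -> A -> K).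
Hypothesis d_refl : forall x, d x x = 0.
Hypothesis d_eq0 : forall x y, d x y = 0 -> x = y.
Hypothesis d_sym : forall x y, d x y = d y x.
Hypothesis d_triangle : forall x y z, d x z <= d x y + d y z.
Hypothesis d_nbhs : forall (x : A) (U : set A),
  nbhs x U <-> exists2 e : K, 0 < e & [set y | d x y < e] `<=` U.
Hypothesis d_complete : forall u : nat -> A,
  (forall e : K, 0 < e -> exists N : nat, forall i j : nat,
     (N <= i)%N -> (N <= j)%N -> d (u i) (u j) < e) ->
  exists l : A, u @ \oo --> l.
Hypothesis A_separable : separable A.

Lemma nbhs_dball (x : A) (e : K) : 0 < e -> nbhs x [set y | d x y < e].
Proof. by move=> e0; apply/d_nbhs; exists e. Qed.

Lemma topmod_dist_sub (x y : A) (e : K) : 0 < e -> exists2 r : K, 0 < r &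
  forall x' y', d x x' < r -> d y y' < r -> d (x - y) (x' - y') < e.
Proof.
move=> e0; have := @sub_continuous A (x, y) _ (nbhs_dball (x - y) e0).
move=> [[P Q] [/= /d_nbhs[r1 r10 P1] /d_nbhs[r2 r20 Q2]] PQ].
exists (Num.min r1 r2) => [|x' y']; first by rewrite lt_min r10.
rewrite !lt_min => /andP[xr1 _] /andP[_ yr2].
by apply: (PQ (x', y')); split; [exact: P1|exact: Q2].
Qed.

Lemma topmod_dist_scale (a : R) (x : A) (e : K) : 0 < e ->
  exists2 r : K, 0 < r & forall x', d x x' < r -> d (a *: x) (a *: x') < e.
Proof.
move=> e0; have := @topmod_scale_continuous R A (a, x) _ (nbhs_dball (a *: x) e0).
move=> [[P Q] [/= Pa /d_nbhs[r r0 Qr]] PQ]; exists r => // x' xr.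
apply: (PQ (a, x')); split; last exact: Qr.
exact: (nbhs_singleton Pa).
Qed.

Lemma topmod_complete (u : nat -> A) : (forall k, [set: A] (u k)) ->
  (forall e : K, 0 < e -> exists N, forall i j, (N <= i)%N -> (N <= j)%N ->
     d (u i) (u j) < e) ->
  exists2 l, [set: A] l &
    forall e : K, 0 < e -> exists N, forall k, (N <= k)%N -> d (u k) l < e.
Proof.
move=> _ /d_complete[l ul]; exists l => // e e0.
have [N _ NP] := ul _ (nbhs_dball l e0).
by exists N => k Nk; rewrite d_sym; exact: NP.
Qed.

Lemma topmod_separable : exists2 D : nat -> A, forall k, [set: A] (D k) &
  forall x (e : K), [set: A] x -> 0 < e -> exists k, d x (D k) < e.
Proof.
have [D0 cD0 dD0] := A_separable.
have D0x (x : A) (e : K) : 0 < e -> exists2 y, D0 y & d x y < e.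
  move=> e0; have [|y [xy Dy]] := dD0 [set y | d x y < e]^° _ (@open_interior _ _).
    by exists x; exact: nbhs_dball.
  by exists y => //; exact: (interior_subset xy).
have [f f_inj] := countable_injP _ cD0.
have /choice[D DP] (n : nat) : exists y : A, forall z, D0 z -> f z = n -> y = z.
  have [[z [Dz zn]]|none] := pselect (exists z, D0 z /\ f z = n).
    by exists z => z' Dz' z'n; apply: f_inj; rewrite ?inE // zn.
  by exists 0 => z Dz zn; case: none; exists z.
exists D => // x e _ e0; have [y Dy xy] := D0x x e e0.
by exists (f y); rewrite (DP (f y) y).
Qed.

Definition topmod_polish : polishGroup K := @PolishGroup K
  A d setT d_refl d_eq0 d_sym d_triangle topmod_dist_sub I (fun _ _ _ _ => I)
  topmod_complete topmod_separable.

Section ClosedConditions.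
Variable I : finType.
Implicit Types (g h : (I -> A) -> A).

Definition jointly_continuous g := forall (x : I -> A) (e : K), 0 < e ->
  exists2 r : K, 0 < r & forall y, (forall i, d (x i) (y i) < r) ->
    d (g x) (g y) < e.

Lemma jointly_continuous0 : jointly_continuous (fun=> 0).
Proof. by move=> x e e0; exists e => // y _; rewrite d_refl. Qed.

Lemma jointly_continuousB g h : jointly_continuous g -> jointly_continuous h ->
  jointly_continuous (fun z => g z - h z).
Proof.
move=> gc hc x e /(topmod_dist_sub (g x) (h x))[r r0 re].
have [s s0 sr] := gc x r r0; have [t t0 tr] := hc x r r0.
exists (Num.min s t) => [|y xy]; first by rewrite lt_min s0.
by apply: re; [apply: sr|apply: tr] => i;
  have := xy i; rewrite lt_min => /andP[].
Qed.

Lemma jointly_continuous_coord (a : R) i :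
  jointly_continuous (fun z => a *: z i).
Proof.
move=> x e /(topmod_dist_scale a (x i))[r r0 re].
by exists r => // y xy; exact: re.
Qed.

Lemma jointly_continuous_sum (J : finType) (g : J -> (I -> A) -> A) :
  (forall j, jointly_continuous (g j)) ->
  jointly_continuous (fun z => \sum_j g j z).
Proof.
move=> gc; elim: (index_enum J) => [|j s IH].
  by under eq_fun do rewrite big_nil; exact: jointly_continuous0.
under eq_fun do rewrite big_cons -[X in _ + X]opprK -[- \sum_(_ <- _) _]sub0r.
apply: jointly_continuousB => //.
by apply: jointly_continuousB => //; exact: jointly_continuous0.
Qed.

Lemma jointly_continuous_closed g (S : set (I -> A)) (x : I -> A) :
  jointly_continuous g -> (forall y, S y -> g y = 0) ->
  (forall e : K, 0 < e -> exists2 y, S y & forall i, d (x i) (y i) < e) ->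
  g x = 0.
Proof.
move=> gc Sg Sx; apply: (@dist_small K topmod_polish) => e e0.
have [r r0 re] := gc x e e0; have [y /Sg gy0 xy] := Sx r r0.
by rewrite -[X in dist _ X]gy0; exact: re.
Qed.

End ClosedConditions.

Section SolutionGroups.
Variables (n m k p l : nat) (C : 'M[R]_(k, m + n)) (D : 'M[R]_(l, p + n)).

Lemma linear_solutions_closed (x : 'I_(m + n) -> A) :
  (forall i, carrier (x i : topmod_polish)) ->
  (forall e : K, 0 < e -> exists2 y, @linear_solutions R A k (m + n) C y &
     forall i, d (x i) (y i) < e) -> linear_solutions C x.
Proof.
move=> _ Cx i; apply: (@jointly_continuous_closed _ (fun z => \sum_j C i j *: z j) _ x _ _ Cx).
  by apply: jointly_continuous_sum => j; exact: jointly_continuous_coord.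
by move=> y /(_ i).
Qed.

Definition solution_group : polishGroup K :=
  @power_subgroup K topmod_polish 'I_(m + n) (@linear_solutions R A k (m + n) C)
    (fun _ _ _ => I) (linear_solutions0 A C)
    (fun x y => @linear_solutionsB R A k (m + n) C x y) linear_solutions_closed.

(** The fibre product of the two solution groups over their free variables.
    Forgetting the second component maps it onto the set of solutions of [C]
    whose free part also satisfies the formula given by [D], which makes that
    set the continuous image of a Polish group. *)
Definition matching : set ('I_(m + n) + 'I_(p + n) -> A) :=
  [set z : 'I_(m + n) + 'I_(p + n) -> A |
    [/\ linear_solutions C (z \o inl), linear_solutions D (z \o inr) &
    forall j, z (inl (rshift m j)) = z (inr (rshift p j))]].

Lemma matching0 : matching 0.
Proof. by split=> //; exact: linear_solutions0. Qed.

Lemma matchingB y z : matching y -> matching z -> matching (y - z).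
Proof.
move=> [Cy Dy yE] [Cz Dz zE]; split; first exact: (linear_solutionsB Cy Cz).
  exact: (linear_solutionsB Dy Dz).
by move=> j; rewrite -[LHS]/(y _ - z _) yE zE.
Qed.

Lemma matching_closed (x : 'I_(m + n) + 'I_(p + n) -> A) :
  (forall i, carrier (x i : topmod_polish)) ->
  (forall e : K, 0 < e -> exists2 y, matching y &
     forall i, d (x i) (y i) < e) -> matching x.
Proof.
move=> _ Mx; split=> [i|i|j].
- apply: (@jointly_continuous_closed _
    (fun z => \sum_j C i j *: z (inl j)) _ x _ _ Mx).
    by apply: jointly_continuous_sum => j; exact: jointly_continuous_coord.
  by move=> y [/(_ i)].
- apply: (@jointly_continuous_closed _
    (fun z => \sum_j D i j *: z (inr j)) _ x _ _ Mx).
    by apply: jointly_continuous_sum => j; exact: jointly_continuous_coord.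
  by move=> y [_ /(_ i)].
- apply/eqP; rewrite -subr_eq0 -[X in X - _]scale1r -[X in _ - X]scale1r.
  apply/eqP/(@jointly_continuous_closed _ (fun z =>
    1 *: z (inl (rshift m j)) - 1 *: z (inr (rshift p j))) _ x _ _ Mx).
    by apply: jointly_continuousB; exact: jointly_continuous_coord.
  by move=> y [_ _ /(_ j)] yE; rewrite !scale1r yE subrr.
Qed.

Definition matching_group : polishGroup K :=
  @power_subgroup K topmod_polish _ matching
    (fun _ _ _ => I) matching0 matchingB matching_closed.

Definition pp_preimage : set solution_group :=
  [set z | linear_solutions C z /\ exists w : 'I_(p + n) -> A,
     linear_solutions D w /\
     (fun j => w (rshift p j)) = (fun j => z (rshift m j))].

Lemma pp_preimage_meager_or_countable_index :
  meager pp_preimage \/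
  exists2 c : nat -> solution_group, forall i, carrier (c i) &
    forall y, carrier y -> exists i, pp_preimage (y - c i).
Proof.
suff <- : (fun z : matching_group => z \o inl : solution_group) @` @carrier _ _
    = pp_preimage.
  apply: image_meager_or_countable_index => //; first by move=> x [].
  move=> x e e0; exists e => // y; apply: le_lt_trans.
  rewrite [leRHS]big_sumType /= lerDl sumr_ge0 // => i _.
  exact: (@dist_ge0 K topmod_polish).
apply/seteqP; split=> [_ [z [Cz Dz zE] <-]|z [Cz [w [Dw wz]]]].
  by split=> //; exists (z \o inr); split=> //; apply/funext => j /=; rewrite zE.
exists (fun i => match i with inl a => z a | inr b => w b end) => //.
by split=> // j; have /(congr1 (@^~ j)) := wz.
Qed.

End SolutionGroups.

Arguments pp_preimage {n m k p l} C D.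

(** A point of a separable metric space is determined by the balls of radius
    1 / (j + 1), centred in a countable dense subset, that contain it. *)
Lemma card_carrier_le (G : polishGroup K) :
  (@carrier K G #<= [set: nat -> bool])%card.
Proof.
have [D _ Dd] := carrier_separable G.
pose f (x : G) (n : nat) := if unpickle n is Some (k, j)
  then dist x (D k) < j.+1%:R^-1 else false.
suff /inj_card_eq/card_esym/card_eqPle[+ _] : {in @carrier K G &, injective f}.
  by move=> /card_le_trans; apply; apply: subset_card_le.
move=> x y; rewrite !inE => cx cy fxy; apply: dist_small => e e0.
have e20 : 0 < e / 2 by lra.
have [j _ /(_ j (leqnn j)) /= je] := near_infty_natSinv_lt (PosNum e20).
have j0 : 0 < j.+1%:R^-1 :> K by rewrite invr_gt0.
have [k xk] := Dd x _ cx j0.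
have yk : dist y (D k) < j.+1%:R^-1.
  by have := congr1 (@^~ (pickle (k, j))) fxy; rewrite /f /= pickleK xk => <-.
apply: (le_lt_trans (dist_triangle x (D k) y)); rewrite (dist_sym (D k)) (splitr e).
by apply: ltrD; [exact: lt_trans je|exact: lt_trans je].
Qed.

(** * The index of the sum of the pp-subgroups *)

Theorem continuum_index n (phi : formula R n) (psi : nat -> formula R n) :
  is_pp phi -> (forall i, is_pp (psi i)) ->
  (forall i, solset A (psi i) `<=` solset A (psi i.+1)) ->
  (forall i, solset A (psi i) `<=` solset A phi) ->
  (forall i, ~ countable (cosets (solset A phi) (solset A (psi i)))) ->
  (cosets (solset A phi) (sum_subgroups (fun i => solset A (psi i)))
     #= [set: nat -> bool])%card.
Proof.
move=> pp_phi pp_psi psiS psi_phi unc.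
set L := sum_subgroups _.
have L0 : L 0.
  exists 0%N, (fun=> 0); split; last by rewrite big_ord0.
  by move=> i; exact: is_pp0.
have psi_le i j : (i <= j)%N -> solset A (psi i) `<=` solset A (psi j).
  move=> /subnKC <-; elim: (j - i)%N => [|h IH]; first by rewrite addn0.
  by rewrite addnS; apply: subset_trans (psiS _).
have Lpsi v : L v -> exists i, solset A (psi i) v.
  move=> [N [g [gpsi ->]]]; exists N.
  elim/big_ind: _ => [|u w pu pw|i _]; first exact: is_pp0.
    rewrite -[w]opprK; apply: is_ppB => //; rewrite -sub0r.
    by apply: is_ppB => //; exact: is_pp0.
  exact: (psi_le _ _ (ltnW (ltn_ord i))).
have /is_ppP[m [k [C phiC]]] := pp_phi.
pose H := solution_group C.
pose proj (z : H) : 'I_n -> A := fun j => z (rshift m j).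
have proj_phi z : carrier z -> solset A phi (proj z).
  by move=> Cz; apply/phiC; exists z.
(* A translate of the preimage of psi i (A) is carried by the projection to a
   coset of psi i (A), so countable index upstairs is countable index below. *)
have mpsi i : meager [set z : H | carrier z /\ solset A (psi i) (proj z)].
  have /is_ppP[p [l [D psiD]]] := pp_psi i.
  have E : pp_preimage C D = [set z : H | carrier z /\ solset A (psi i) (proj z)].
    by apply/seteqP; split=> z [Cz]; [move/psiD|move/psiD].
  have [|[c cc cH]] := pp_preimage_meager_or_countable_index C D; first by rewrite E.
  case: (unc i); apply: (@sub_countable _ _ _
    (range (fun j => [set proj (c j) + y | y in solset A (psi i)]))); last first.
    exact: (sub_countable (card_image_le _ _) (countableP _)).
  apply: subset_card_le => _ [v /phiC[z [Cz <-]] <-].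
  have [j] := cH z Cz; rewrite E => -[_ psi_zc]; exists j => //.
  apply/esym/coset_eq; [exact: is_pp0|exact: is_ppB|exact: psi_zc].
apply: Cantor_Bernstein.
  apply: card_le_trans (card_image_le _ _) _.
  apply: card_le_trans (subset_card_le (@subsetT _ _)) _.
  have T0 : [set: 'I_n -> A] 0 by [].
  exact: (@card_carrier_le (@power_subgroup K topmod_polish 'I_n setT
    (fun _ _ _ => I) I (fun _ _ _ _ => I) (fun _ _ _ => I))).
have [X cX Xm] := cantor_scheme (meager_bigcup mpsi).
pose coset h := [set proj (X h) + y | y in L].
have separated h h' : coset h = coset h' -> forall i, h i -> h' i.
  move=> hh' i hi; apply: contrapT => /negP h'i.
  apply: (Xm h h'); first by exists i.
  have [j psi_j] := Lpsi _ (coset_eqB L0 hh').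
  by exists j => //; split=> //; exact: carrierB.
have /inj_card_eq/card_esym : {in [set: nat -> bool] &, injective coset}.
  move=> h h' _ _ hh'; apply/funext => i; apply/idP/idP; exact: separated.
move=> /card_eqPle[+ _] => /card_le_trans; apply; apply: subset_card_le.
by move=> _ [h _ <-]; exists (proj (X h)) => //; exact: proj_phi.
Qed.

End PolishModule.

Theorem theorem1p2 (K : realType) (R : nzRingType) (A : topModType R)
    (n : nat) (phi : formula R n) (psi : nat -> formula R n) :
  countable [set: R] ->
  polish K A ->
  ~ countable [set: A] ->
  is_pp phi ->
  (forall i, is_pp (psi i)) ->
  (forall i, solset A (psi i) `<=` solset A (psi i.+1)) ->
  (forall i, solset A (psi i) `<=` solset A phi) ->
  consistent (Th_Pun A) (pp_type phi psi) ->
  (cosets (solset A phi) (sum_subgroups (fun i => solset A (psi i)))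
     #= [set: nat -> bool])%card.
Proof.
move=> _ [sepA [d [[d_refl d_eq0 d_sym d_triangle] d_nbhs d_complete]]] _.
move=> pp_phi pp_psi psiS psi_phi cons.
apply: (continuum_index d_refl d_eq0 d_sym d_triangle d_nbhs d_complete sepA) => //.
by move=> i; exact: (uncountable_index pp_phi (pp_psi i) (psi_phi i) cons).
Qed.
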